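(* For every $\varepsilon>0$ there exists $\Delta_{\varepsilon}$ such that for every graph $G$ with maximum degree $\Delta\ge\Delta_{\varepsilon}$, $$\chi'_{\rm cf}(G)\leq (1+\varepsilon)\log_2\Delta.$$
   Context: All graphs are simple and finite. For a graph $G=(V,E)$ and a vertex $v$, $E(v)$ is the set of edges incident with $v$. For an edge $e=uv$, its closed neighbourhood is $E[e]=E(u)\cup E(v)$ and its open neighbourhood is $E(e)=E[e]\setminus\{e\}$. An edge $e$ is isolated if $E(e)=\emptyset$. Given a partial edge colouring $c$ of $G$ (not all edges need be coloured), a colour $\alpha$ is unique for an edge $e$ if $\alpha$ appears on some edge $e'\in E(e)$ and does not appear on any other edge of $E[e]\setminus\{e'\}$; if such a colour exists, $e$ is satisfied by $c$. An edge colouring of all edges of $G$ is conflict-free if every non-isolated edge of $G$ is satisfied. The conflict-free chromatic index $\chi'_{\rm cf}(G)$ is the minimum number of colours in a conflict-free colouring of all edges of $G$. *)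

(* Defs.v *)
From mathcomp Require Import all_boot.
From Stdlib Require Import Reals.
Set Implicit Arguments. Unset Strict Implicit. Unset Printing Implicit Defensive.

Section CF.
Variables (T : finType) (adj : rel T).

(* Simple graph on vertex set T: adj symmetric and irreflexive (hypotheses in
   the theorem).  Edges are the 2-sets {u,v} with adj u v. *)
Definition edges : {set {set T}} := [set [set u; v] | u in T, v in T & adj u v].

Definition incident (v : T) : {set {set T}} := [set g in edges | v \in g].
Definition closedN (f : {set T}) : {set {set T}} := \bigcup_(v in f) incident v.
Definition openN (f : {set T}) : {set {set T}} := closedN f :\ f.
Definition isolated (f : {set T}) : bool := openN f == set0.

Definition unique_col k (c : {ffun {set T} -> 'I_k}) (f : {set T}) (a : 'I_k) : bool :=
  [exists f', [&& f' \in openN f, c f' == a &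
                 [forall g in closedN f :\ f', c g != a]]].
Definition satisfied k (c : {ffun {set T} -> 'I_k}) (f : {set T}) : bool :=
  [exists a, unique_col c f a].
(* a colouring of (all edges, values off edges irrelevant) with colours 'I_k *)
Definition conflict_free k (c : {ffun {set T} -> 'I_k}) : bool :=
  [forall f in edges, ~~ isolated f ==> satisfied c f].
Definition has_cf_col (k : nat) : bool := [exists c : {ffun {set T} -> 'I_k}, conflict_free c].

Lemma has_cf_col_exists : exists k, has_cf_col k.
Proof.
pose s := enum edges; exists (size s).+1.
apply/existsP; exists [ffun f => inord (index f s)].
apply/forallP => f; apply/implyP => _; apply/implyP => nis.
have [f' Hf'] : exists f', f' \in openN f.
  by apply/set0Pn; exact: nis.
apply/existsP; exists (inord (index f' s)); apply/existsP; exists f'.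
rewrite Hf' ffunE eqxx /=; apply/forallP => g; apply/implyP => Hg.
have f'E : f' \in edges.
  move: Hf'; rewrite /openN /closedN in_setD1 => /andP[_] /bigcupP[v _].
  by rewrite inE => /andP[].
have gE : g \in edges.
  move: Hg; rewrite /closedN in_setD1 => /andP[_] /bigcupP[v _].
  by rewrite inE => /andP[].
move: Hg; rewrite in_setD1 => /andP[ngf _].
rewrite ffunE; apply/negP => /eqP /(congr1 (@nat_of_ord _)).
rewrite !inordK ?ltnS ?index_size //.
move=> eqi; move/negP: ngf; apply.
by rewrite -(nth_index f' (s:=s) (x:=g)) ?mem_enum // eqi nth_index ?mem_enum.
Qed.

Definition cf_index : nat := ex_minn has_cf_col_exists.

Definition maxdeg : nat := \max_(v : T) #|[set u | adj v u]|.
End CF.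

Definition log2 (x : R) : R := (ln x / ln 2)%R.

(* Main.v *)
Require Import Defs.
From Stdlib Require Import Reals Lra.
From mathcomp Require Import all_boot zify.
Set Implicit Arguments. Unset Strict Implicit. Unset Printing Implicit Defensive.

(** A matching [M] satisfies, as a colour class, every edge with exactly one end
    covered by [M].  If [M] is maximal among the edges not yet used, every other
    such edge [e] meets one or two edges of [M], so a uniformly random subset of
    [M] satisfies [e] with probability 1/2.  With [k] successive maximal
    matchings, [e] stays unsatisfied with probability [2 ^ - k] and depends on
    [O(k * Delta)] other edges; the local lemma thus needs only
    [k = log2 Delta + O(log2 (log2 Delta))] colours for the edges outside the
    matchings.  The edges in these [k] matchings have maximum degree [k], so [t]
    earlier matchings with [t = O(log2 k)] take care of them in the same way.
    The edges of those [t] matchings are satisfied by the first two maximal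
    matchings [N1], [N2], coloured greedily with [O(t)] colours so that no two
    edges of [N1 :|: N2] near a common edge share a colour.  This leaves the set
    [Z] of non-isolated edges of [N1] which [N2] misses: no edge joins two members
    of [Z], so one colour for [Z] satisfies all other edges meeting [Z], and one
    colour for a chosen neighbour of each member of [Z] satisfies [Z]. *)

(** * Union bounds and greedy levels *)

Lemma leq_card_bigcup (I V : finType) (A : {set I}) (F : I -> {set V}) :
  #|\bigcup_(i in A) F i| <= \sum_(i in A) #|F i|.
Proof.
elim/big_rec2: _ => [|i n B _ leBn]; first by rewrite cards0.
by apply: leq_trans (leq_card_setU _ _) _; rewrite leq_add2l.
Qed.

Lemma leq_card_bigcup_const (I V : finType) (A : {set I}) (F : I -> {set V}) d :
  (forall i, i \in A -> #|F i| <= d) -> #|\bigcup_(i in A) F i| <= #|A| * d.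
Proof.
move=> Fd; apply: leq_trans (leq_card_bigcup _ _) _.
by rewrite -sum_nat_const; apply: leq_sum.
Qed.

(** Elements are inserted one by one, each at the least level free among its neighbours, and later
    insertions keep earlier witnesses. For [meets], the levels are successive maximal matchings. *)
Lemma grundy_colouring (V : finType) (r : rel V) (A : {set V}) :
  symmetric r ->
  exists lev : V -> nat,
    (forall x y, x \in A -> y \in A -> r x y -> lev x = lev y -> x = y) /\
    (forall x j, x \in A -> j < lev x ->
       exists y, [/\ y \in A, r x y & lev y = j]).
Proof.
move=> rC; have [n] := ubnP #|A|; elim: n A => // n IHn A leAn.
have [->|[x xA]] := set_0Vmem A; first by exists (fun=> 0); split=> ? ?; rewrite inE.
have [|lev [lev_inj lev_min]] := IHn (A :\ x).
  by rewrite (cardsD1 x A) xA in leAn.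
pose free j := ~~ [exists y in A :\ x, r x y && (lev y == j)].
have free_ex : exists j, free j.
  exists (\max_(y in A :\ x) lev y).+1; apply/negP => /existsP[y /and3P[yA _ /eqP]].
  by move=> levy; have := leq_bigmax_cond (F := lev) y yA; rewrite levy ltnn.
case: (ex_minnP free_ex) => m free_m min_m.
pose lev' y := if y == x then m else lev y.
have free_lev y : y \in A -> y != x -> r x y -> lev y <> m.
  move=> yA yx rxy lym; move/negP: free_m; apply; apply/existsP; exists y.
  by rewrite in_setD1 yx yA rxy lym eqxx.
exists lev'; split=> [y z yA zA|y j yA]; rewrite /lev'.
  case: eqVneq => [->|yx]; case: eqVneq => [->|zx] // ryz.
  - by move=> /esym /(free_lev _ zA zx ryz).
  - by rewrite rC in ryz; move=> /(free_lev _ yA yx ryz).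
  - by apply: lev_inj => //; rewrite in_setD1 ?yx ?zx.
case: eqVneq => [->|yx] jlt.
  have /negPn/existsP[z /and3P[zA rxz /eqP zj]] : ~~ free j.
    by apply/negP => /min_m; lia.
  by exists z; move: zA; rewrite in_setD1 => /andP[/negPf-> ->].
have [|z [zA ryz zj]] := lev_min y j _ jlt; first by rewrite in_setD1 yx.
by exists z; move: zA; rewrite in_setD1 => /andP[/negPf-> ->].
Qed.

Lemma grundy_le (V : finType) (r : rel V) (A : {set V}) (lev : V -> nat) x d :
  (forall j, j < lev x -> exists y, [/\ y \in A, r x y & lev y = j]) ->
  #|[set y in A | r x y]| <= d -> lev x <= d.
Proof.
move=> lev_min; apply: leq_trans.
rewrite cardE -(size_map lev) -{1}(size_iota 0 (lev x)).
apply: uniq_leq_size (iota_uniq _ _) _ => j.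
rewrite mem_iota => /andP[_ /lev_min[y [yA rxy <-]]].
by rewrite map_f // mem_enum inE yA.
Qed.

(** * The local lemma by counting *)

Definition avoid (W I : finType) (B : I -> {set W}) (A : {set I}) : {set W} :=
  [set w | [forall i in A, w \notin B i]].

Lemma avoidP (W I : finType) (B : I -> {set W}) (A : {set I}) w :
  reflect (forall i, i \in A -> w \notin B i) (w \in avoid B A).
Proof. by rewrite inE; apply: forall_inP. Qed.

Lemma avoid_sub (W I : finType) (B : I -> {set W}) (A A' : {set I}) :
  A \subset A' -> avoid B A' \subset avoid B A.
Proof.
move/subsetP=> AA'; apply/subsetP => w /avoidP wA'.
by apply/avoidP => i /AA'; apply: wA'.
Qed.

(* Probabilities are replaced by cardinalities: an event has probability at
   most [1 / N] conditionally on avoiding events it is not related to. *)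
Lemma local_lemma (W I : finType) (B : I -> {set W}) (F : {set I}) (r : rel I) N D :
  0 < #|W| -> 2 < N -> 4 * D <= N ->
  (forall i, i \in F -> #|[set j in F | r i j]| <= D) ->
  (forall i (A : {set I}), i \in F -> A \subset F ->
     (forall j, j \in A -> ~~ r i j) ->
     N * #|B i :&: avoid B A| <= #|avoid B A|) ->
  exists w, forall i, i \in F -> w \notin B i.
Proof.
move=> W0 N2 DN rD indep.
(* Conditioning on all of [A] weakens [1 / N] only to [2 / N]: restoring the at most [D] related
   indices removes a fraction at most [D * 2 / N <= 1 / 2] of [avoid B A2]. *)
have cond n (A : {set I}) i : #|A| <= n -> A \subset F -> i \in F ->
    N * #|B i :&: avoid B A| <= 2 * #|avoid B A|.
  elim: n A i => [|n IHn] A i leAn AF iF.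
    have A0 j : j \in A = false.
      by move: leAn; rewrite leqn0 cards_eq0 => /eqP->; rewrite inE.
    by apply: leq_trans (indep i A iF AF _) _; [move=> j; rewrite A0 | lia].
  pose A1 := [set j in A | r i j]; pose A2 := A :\: A1.
  have A2F : A2 \subset F by apply: subset_trans (subsetDl _ _) AF.
  have A2r j : j \in A2 -> ~~ r i j.
    by rewrite !inE negb_and; case: (j \in A) => //=; rewrite andbT.
  have [A10|/set0Pn[j0 j0A1]] := eqVneq A1 set0.
    have AA2 : A = A2 by rewrite /A2 A10 setD0.
    by apply: leq_trans (indep i A iF AF _) _; [rewrite {1}AA2 | lia].
  have A2n : #|A2| <= n.
    rewrite -ltnS; apply: leq_trans leAn; apply: proper_card.
    apply/properP; split; first exact: subsetDl.
    by exists j0; [move: j0A1; rewrite inE => /andP[] | rewrite in_setD j0A1].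
  have A1D : #|A1| <= D.
    apply: leq_trans (rD i iF); apply: subset_leq_card; apply/subsetP => j.
    by rewrite !inE => /andP[/(subsetP AF)-> ->].
  have le1 : N * #|B i :&: avoid B A| <= #|avoid B A2|.
    apply: leq_trans (indep i A2 iF A2F A2r); rewrite leq_mul2l.
    by rewrite subset_leq_card ?orbT // setIS // avoid_sub // subsetDl.
  have le2 : #|avoid B A2| <=
      #|avoid B A| + #|\bigcup_(j in A1) (B j :&: avoid B A2)|.
    apply: leq_trans (leq_card_setU _ _); apply: subset_leq_card.
    apply/subsetP => w wA2; rewrite inE; have [//|wA /=] := boolP (w \in avoid B A).
    have [j jA wj] : exists2 j, j \in A & w \in B j.
      move: wA; rewrite inE => /forall_inPn[j jA /negPn wj]; by exists j.
    apply/bigcupP; exists j; last by rewrite inE wj.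
    have : j \notin A2 by apply/negP => /(avoidP _ _ _ wA2); rewrite wj.
    by rewrite in_setD jA andbT negbK.
  have le3 : N * #|\bigcup_(j in A1) (B j :&: avoid B A2)| <= D * (2 * #|avoid B A2|).
    apply: (@leq_trans (#|A1| * (2 * #|avoid B A2|))); last by rewrite leq_mul2r A1D orbT.
    rewrite -sum_nat_const.
    apply: (@leq_trans (\sum_(j in A1) N * #|B j :&: avoid B A2|)).
      by rewrite -big_distrr leq_mul2l leq_card_bigcup orbT.
    apply: leq_sum => j; rewrite inE => /andP[/(subsetP AF) jF _].
    exact: IHn.
  move: le1 le2 le3; move: #|avoid B A2| => a2; move: #|avoid B A| => a.
  by move: #|_| => b; move: #|_| => c; nia.
(* Each further event removes a fraction at most [2 / N < 1] of what is left. *)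
have pos n (A : {set I}) : #|A| <= n -> A \subset F -> 0 < #|avoid B A|.
  elim: n A => [|n IHn] A leAn AF.
    suff -> : avoid B A = [set: W] by rewrite cardsT.
    apply/setP => w; rewrite in_setT; apply/avoidP => i.
    by move: leAn; rewrite leqn0 cards_eq0 => /eqP->; rewrite inE.
  have [A0|[i iA]] := set_0Vmem A; first by apply: IHn; rewrite ?A0 ?cards0 ?sub0set.
  have iF := subsetP AF _ iA.
  have AiF : A :\ i \subset F by apply: subset_trans (subsetDl _ _) AF.
  have Ain : #|A :\ i| <= n by move: leAn; rewrite (cardsD1 i A) iA.
  have gt0 := IHn _ Ain AiF; have le := cond n _ i Ain AiF iF.
  have -> : avoid B A = avoid B (A :\ i) :\: B i.
    apply/setP => w; rewrite in_setD; apply/avoidP/andP => [wA|[wi /avoidP wA] j jA].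
      by split; [apply: wA | apply/avoidP => j; rewrite in_setD1 => /andP[_]; apply: wA].
    by have [->//|ji] := eqVneq j i; apply: wA; rewrite in_setD1 ji.
  move: le gt0; rewrite setIC -(cardsID (B i) (avoid B (A :\ i))).
  by move: #|_| => b; move: #|_| => c; nia.
have /card_gt0P[w /avoidP wF] := pos _ F (leqnn _) (subxx _).
by exists w.
Qed.

(** * Meeting edges and degrees *)

Definition meets (T : finType) : rel {set T} := fun e f => e :&: f != set0.

Lemma meetsP (T : finType) (e f : {set T}) :
  reflect (exists2 v, v \in e & v \in f) (meets e f).
Proof.
apply: (iffP (set0Pn _)) => [[v]|[v ve vf]]; first by rewrite inE => /andP[]; exists v.
by exists v; rewrite inE ve.
Qed.

Lemma meetsC (T : finType) : symmetric (@meets T).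
Proof. by move=> e f; rewrite /meets setIC. Qed.

Definition degree_le (T : finType) (X : {set {set T}}) (d : nat) :=
  forall v : T, #|[set e in X | v \in e]| <= d.

Lemma card_meets (T : finType) (X : {set {set T}}) d (e : {set T}) :
  degree_le X d -> #|e| <= 2 -> #|[set f in X | meets e f]| <= 2 * d.
Proof.
move=> Xd e2; apply: leq_trans (_ : #|e| * d <= _); last by rewrite leq_mul2r e2 orbT.
apply: leq_trans (leq_card_bigcup_const (F := fun v => [set f in X | v \in f]) _) => //.
apply: subset_leq_card; apply/subsetP => f; rewrite inE => /andP[fX /meetsP[v ve vf]].
by apply/bigcupP; exists v; rewrite // inE fX.
Qed.

(** Edges at a common vertex meet, hence have distinct levels, and the window holds only [n]
    levels. *)
Lemma degree_le_levels (T : finType) (X : {set {set T}}) (lev : {set T} -> nat) a n :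
  (forall e f, e \in X -> f \in X -> meets e f -> lev e = lev f -> e = f) ->
  degree_le [set e in X | a <= lev e < a + n] n.
Proof.
move=> lev_inj v; rewrite cardE -(size_map lev) -[leqRHS](size_iota a n).
apply: uniq_leq_size.
  rewrite map_inj_in_uniq ?enum_uniq // => e f; rewrite !mem_enum !inE.
  move=> /andP[/andP[eX _] ve] /andP[/andP[fX _] vf]; apply: lev_inj => //.
  by apply/meetsP; exists v.
move=> j /mapP[e]; rewrite mem_enum !inE mem_iota.
by move=> /andP[/andP[_ lev_e] _] ->.
Qed.

Lemma degree_leU (T : finType) (X Y : {set {set T}}) m n :
  degree_le X m -> degree_le Y n -> degree_le (X :|: Y) (m + n).
Proof.
move=> Xm Yn v; apply: leq_trans (leq_add (Xm v) (Yn v)).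
apply: leq_trans (leq_card_setU _ _); apply: subset_leq_card.
by apply/subsetP => e; rewrite !inE -andb_orl.
Qed.

Lemma degree_leS (T : finType) (X Y : {set {set T}}) n :
  X \subset Y -> degree_le Y n -> degree_le X n.
Proof.
move=> /subsetP XY Yn v; apply: leq_trans (Yn v); apply: subset_leq_card.
by apply/subsetP => e; rewrite !inE => /andP[/XY-> ->].
Qed.

Lemma meets_pigeonhole (T : finType) (e f g h : {set T}) : #|e| <= 2 ->
  meets e f -> meets e g -> meets e h -> [|| meets f g, meets f h | meets g h].
Proof.
move=> e2 /meetsP[x xe xf] /meetsP[y ye yg] /meetsP[z ze zh].
have [xy|xy] := eqVneq x y; first by apply/or3P/Or31/meetsP; exists x; rewrite // xy.
have [xz|xz] := eqVneq x z; first by apply/or3P/Or32/meetsP; exists x; rewrite // xz.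
have [yz|yz] := eqVneq y z; first by apply/or3P/Or33/meetsP; exists y; rewrite // yz.
have : #|[set x; y; z]| <= #|e|.
  by apply/subset_leq_card/subsetP => w; rewrite !inE => /orP[/orP[]|] /eqP->.
by rewrite -setUA cardsU1 cards2 !inE negb_or xy xz yz /=; lia.
Qed.

(** * Random subsets of successive matchings *)

Definition singly_met (T : finType) (X : {set {set T}}) (e : {set T}) :=
  exists f, [/\ f \in X, meets e f & forall g, g \in X -> meets e g -> g = f].

(* [S] is a uniformly random set of edges.  If [m j] is an edge of level [j]
   meeting [e], then whether [m j] lies in [S] is determined by the rest of [S] as
   soon as [e] is not met exactly once on level [j].  So toggling any subset of
   the [m j] maps bad sets injectively, which bounds their density by [2 ^ - t]. *)
Lemma random_submatchings (T : finType) (F X : {set {set T}})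
    (lev : {set T} -> nat) a t d :
  1 < t -> 16 * t * d <= 2 ^ t ->
  (forall e, e \in F -> #|e| <= 2) -> (forall e, e \in X -> #|e| <= 2) ->
  degree_le F d ->
  (forall e f, e \in X -> f \in X -> meets e f -> lev e = lev f -> e = f) ->
  (forall e j, e \in F -> a <= j < a + t ->
     exists f, [/\ f \in X, meets e f & lev f = j]) ->
  exists S : {set {set T}}, forall e, e \in F ->
    exists2 j, a <= j < a + t & singly_met [set f in X :&: S | lev f == j] e.
Proof.
move=> t1 td F2 X2 Fd lev_inj lev_met.
(* The event [B e] depends only on [S] inside [W e], so [r] serves as the dependency relation. *)
pose W e := [set f in [set f in X | a <= lev f < a + t] | meets e f].
pose once (S : {set {set T}}) e j :=
  [exists f in [set f in X :&: S | lev f == a + j], meets e f &&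
     [forall g in [set f in X :&: S | lev f == a + j], meets e g ==> (g == f)]].
pose B e := [set S : {set {set T}} | [forall j : 'I_t, ~~ once S e j]].
pose r e e' := W e :&: W e' != set0.
have once_dep e (S S' : {set {set T}}) (j : 'I_t) :
    (forall g, g \in W e -> (g \in S) = (g \in S')) ->
  once S e j -> once S' e j.
  move=> SS' /existsP[f /and3P[]]; rewrite !inE => /andP[/andP[fX fS] /eqP lf] ef.
  have inW g : g \in X -> meets e g -> lev g = a + j -> g \in W e.
    by move=> gX eg lg; rewrite !inE gX eg lg; have := ltn_ord j; lia.
  move=> /forall_inP fu; apply/existsP; exists f; apply/and3P; split => //.
    by rewrite !inE fX lf eqxx -SS' ?fS // inW.
  apply/forall_inP => g; rewrite !inE => /andP[/andP[gX gS] /eqP lg].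
  apply/implyP => eg; apply: (implyP (fu g _)) => //.
  by rewrite !inE gX lg eqxx SS' ?gS // inW.
have [|||e eF|e A eF AF Ar|S SB] := @local_lemma _ _ B F r (2 ^ t) (4 * t * d).
- by apply/card_gt0P; exists set0.
- by apply: leq_ltn_trans (_ : 2 ^ 1 < _) => //; rewrite ltn_exp2l.
- by move: td; lia.
(* At most [2 * t] edges lie in [W e], and each meets at most [2 * d] members of [F]. *)
- have -> : 4 * t * d = (2 * t) * (2 * d) by lia.
  apply: (@leq_trans (#|W e| * (2 * d))); last first.
    rewrite leq_mul2r card_meets ?orbT //; last exact: F2.
    exact: degree_le_levels.
  apply: leq_trans (leq_card_bigcup_const (F := fun g => [set f in F | meets g f]) _).
    apply/subset_leq_card/subsetP => f; rewrite inE => /andP[fF /set0Pn[g]].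
    rewrite inE => /andP[gWe]; rewrite inE => /andP[_ fg].
    by apply/bigcupP; exists g => //; rewrite inE fF meetsC.
  move=> g; rewrite !inE => /andP[/andP[gX _] _]; apply: card_meets => //.
  exact: X2.
- have /fin_all_exists[m m_spec] (j : 'I_t) :
      exists f, [/\ f \in X, meets e f & lev f = a + j].
    by apply: lev_met => //; have := ltn_ord j; lia.
  have mX j : m j \in X by case: (m_spec j).
  have me j : meets e (m j) by case: (m_spec j).
  have lm j : lev (m j) = a + j by case: (m_spec j).
  have m_inj : injective m.
    by move=> i j mij; apply: val_inj; move: (lm i) (lm j); rewrite mij => /= ->; lia.
  pose flip (S : {set {set T}}) (J : {set 'I_t}) :=
    [set g | (g \in S) (+) (g \in m @: J)].
  have card_pow : 2 ^ t = #|powerset [set: 'I_t]|.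
    by rewrite card_powerset cardsT card_ord.
  rewrite card_pow mulnC -cardsX.
  set D := setX _ _.
  rewrite -(card_in_imset (f := fun SJ => flip SJ.1 SJ.2) (D := D)).
    apply/subset_leq_card/subsetP => _ /imsetP[[S J] + ->] /=.
    rewrite in_setX => /andP[/setIP[_ /avoidP SA] _].
    (* Toggling changes only edges of [W e], which is disjoint from [W i], so [B i] is still
       avoided. *)
    apply/avoidP => i iA; have := SA i iA; apply: contra; rewrite !inE.
    move=> /forallP iB; apply/forallP => j; have := iB j; apply: contra.
    apply: once_dep => // g gW; rewrite inE.
    case: imsetP => [[j' _ gm]|_]; last by rewrite addbF.
    case/negP: (Ar i iA); apply/set0Pn; exists g; rewrite inE gW andbT.
    by rewrite !inE gm mX me lm; have := ltn_ord j'; lia.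
  (* By [meets_pigeonhole], at most two edges of level [a + j] meet [e]. A bad set never contains
     exactly one of them, so the other one, if any, decides whether [m j] belongs to it. *)
  have agree (S S' : {set {set T}}) (j : 'I_t) : S \in B e -> S' \in B e ->
      (forall g, g \notin m @: [set: 'I_t] -> (g \in S) = (g \in S')) ->
      m j \in S -> m j \in S'.
    rewrite !inE => /forallP/(_ j) nS /forallP/(_ j) nS' SS' mS.
    have agree1 g : g \in X -> lev g = a + j -> g != m j -> (g \in S) = (g \in S').
      move=> gX lg gm; apply: SS'; apply/imsetP => [[i _ gi]].
      move: lg; rewrite gi lm => ij; case/eqP: gm; rewrite gi; congr m.
      by apply: val_inj => /=; lia.
    have another R f : ~~ once R e j -> f \in X -> lev f = a + j -> meets e f ->
        f \in R ->
        exists g, [&& g \in X, lev g == a + j, meets e g, g \in R & g != f].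
      move=> nR fX lf ef fR; apply/existsP; move: nR; apply: contraR => /existsPn no.
      apply/existsP; exists f; rewrite !inE fX fR lf ef eqxx /=.
      apply/forall_inP => g; rewrite !inE => /andP[/andP[gX gR] lg].
      apply/implyP => eg; apply: contraR (no g) => gf.
      by rewrite gX lg eg gR.
    have [g /and5P[gX /eqP lg eg gS gm]] := another S (m j) nS (mX j) (lm j) (me j) mS.
    apply: contraT => mS'.
    have gS' : g \in S' by rewrite -agree1.
    have [h /and5P[hX /eqP lh eh hS' hg]] := another S' g nS' gX lg eg gS'.
    have hm : h != m j by apply: contraNneq mS' => <-.
    have /or3P[] := meets_pigeonhole (F2 e eF) (me j) eg eh.
    - by move=> /lev_inj-/(_ (mX j) gX)gm'; rewrite gm' ?lm ?lg ?eqxx in gm.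
    - by move=> /lev_inj-/(_ (mX j) hX)hm'; rewrite hm' ?lm ?lh ?eqxx in hm.
    - by move=> /lev_inj-/(_ gX hX)hg'; rewrite hg' ?lg ?lh ?eqxx in hg.
  move=> [S J] [S' J'] /=; rewrite !in_setX => /andP[/setIP[SB _] _].
  move=> /andP[/setIP[S'B _] _] /setP flipE.
  have SS' g : g \notin m @: [set: 'I_t] -> (g \in S) = (g \in S').
    move=> gm; have := flipE g; rewrite !inE.
    have nm (K : {set 'I_t}) : g \in m @: K = false.
      by apply: contraNF gm; apply/subsetP/imsetS/subsetT.
    by rewrite !nm !addbF.
  have mSS' j : (m j \in S) = (m j \in S').
    by apply/idP/idP; apply: agree => // g gm; rewrite SS'.
  have JJ' : J = J'.
    apply/setP => j; have := flipE (m j); rewrite !inE !mem_imset // mSS'.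
    exact: addbI.
  congr (_, _) => //; apply/setP => g; have := flipE g; rewrite !inE JJ'.
  exact: addIb.
exists S => e eF; have := SB e eF; rewrite inE => /forallPn[j /negPn /existsP[f]].
move=> /and3P[fL ef /forall_inP fu]; exists (a + j); first by have := ltn_ord j; lia.
exists f; split => // g gL eg; apply/eqP.
exact: (implyP (fu g gL)).
Qed.

(** * From the graph to sets of meeting edges *)

Lemma card_edge (T : finType) (adj : rel T) e :
  irreflexive adj -> e \in edges adj -> #|e| = 2.
Proof.
move=> adj_irr /imset2P[u v _]; rewrite inE => /andP[_ uv] ->.
by rewrite cards2; case: eqVneq uv => // ->; rewrite adj_irr.
Qed.

Lemma degree_le_edges (T : finType) (adj : rel T) :
  symmetric adj -> degree_le (edges adj) (maxdeg adj).
Proof.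
move=> adjC v; apply: leq_trans (_ : #|[set u | adj v u]| <= _); last first.
  exact: (leq_bigmax (F := fun v => #|[set u | adj v u]|)).
apply: leq_trans (leq_imset_card (fun u => [set v; u]) _).
apply/subset_leq_card/subsetP => e; rewrite inE => /andP[/imset2P[x y _]].
rewrite inE => /andP[_ xy] ->; rewrite !inE => /orP[] /eqP->.
  by apply/imsetP; exists y; rewrite ?inE.
by apply/imsetP; exists x; rewrite ?inE 1?adjC // setUC.
Qed.

Lemma closedN_meets (T : finType) (adj : rel T) e g :
  (g \in closedN adj e) = (g \in edges adj) && meets e g.
Proof.
apply/bigcupP/andP => [[v ve]|[gE /meetsP[v ve vg]]].
  by rewrite inE => /andP[gE vg]; split=> //; apply/meetsP; exists v.
by exists v; rewrite // inE gE.
Qed.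

Lemma nonisolatedP (T : finType) (adj : rel T) e :
  reflect (exists f, [/\ f \in edges adj, f != e & meets e f]) (~~ isolated adj e).
Proof.
apply: (iffP (set0Pn _)) => [[f]|[f [fE fe ef]]]; last first.
  by exists f; rewrite in_setD1 fe closedN_meets fE.
by rewrite in_setD1 closedN_meets => /and3P[fe fE ef]; exists f.
Qed.

(** This allows colours in [nat]. Since [e] meets itself, the uniqueness clause also gives
    [c e <> c f]. *)
Lemma cf_index_le (T : finType) (adj : rel T) (c : {set T} -> nat) n :
  (forall e, e \in edges adj -> c e < n.+1) ->
  (forall e, e \in edges adj -> ~~ isolated adj e ->
     exists f, [/\ f \in edges adj, f != e, meets e f &
       forall g, g \in edges adj -> meets e g -> c g = c f -> g = f]) ->
  cf_index adj <= n.+1.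
Proof.
move=> c_lt c_uniq; rewrite /cf_index; case: ex_minnP => m _; apply.
apply/existsP; exists [ffun e => inord (c e)]; apply/forall_inP => e eE.
apply/implyP => /(c_uniq e eE)[f [fE fe ef fu]].
apply/existsP; exists (inord (c f)); apply/existsP; exists f.
rewrite in_setD1 fe closedN_meets fE ef ffunE eqxx /=.
apply/forall_inP => g; rewrite in_setD1 closedN_meets => /and3P[gf gE eg].
rewrite ffunE; apply: contra gf => /eqP/(congr1 val) /=.
by rewrite !inordK ?c_lt // => /fu->.
Qed.

(** * The colouring for given numbers of matchings *)

Lemma cf_index_bound (T : finType) (adj : rel T) t k :
  symmetric adj -> irreflexive adj -> 1 < t -> 1 < k ->
  16 * t * k <= 2 ^ t -> 16 * k * maxdeg adj <= 2 ^ k ->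
  cf_index adj <= 20 + 9 * t + k.
Proof.
move=> adjC adj_irr t1 k1 tk kD; set E := edges adj.
have E2 e : e \in E -> #|e| <= 2 by move=> /(card_edge adj_irr)->.
have [lev1 [inj1 min1]] := grundy_colouring E (@meetsC T).
pose Z := [set e in E | [&& lev1 e == 0, ~~ isolated adj e &
                          ~~ [exists f in E, meets e f && (lev1 f == 1)]]].
have ZE z : z \in Z -> z \in E by rewrite inE => /andP[].
have Z0 z : z \in Z -> lev1 z = 0 by rewrite inE => /and4P[_ /eqP].
have Z1 z f : z \in Z -> f \in E -> meets z f -> lev1 f != 1.
  rewrite inE => /and4P[_ _ _ /existsPn/(_ f)] + fE zf; rewrite fE zf /=.
  by move->.
have Zlev z g : z \in Z -> g \in E -> meets z g -> g != z -> 2 <= lev1 g.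
  move=> zZ gE zg gz; have := Z1 z g zZ gE zg.
  suff : lev1 g != 0 by lia.
  apply: contra gz => /eqP lg; apply/eqP; apply: (inj1 _ _ gE (ZE z zZ)); rewrite 1?meetsC //.
  by rewrite lg Z0.
(* A neighbour [g] of [z] has level at least 2, so it meets some [f] of level 1. Among [z], [z'],
   [f] two must meet, and [f] meets no member of [Z]. *)
have Zuniq z z' g : z \in Z -> z' \in Z -> g \in E -> g != z ->
    meets z g -> meets z' g -> z = z'.
  move=> zZ z'Z gE gz zg z'g.
  have [f [fE gf lf]] := min1 g 1 gE (Zlev z g zZ gE zg gz).
  rewrite meetsC in zg; rewrite meetsC in z'g.
  have /or3P[zz'|zf|z'f] := meets_pigeonhole (E2 g gE) zg z'g gf.
  - by apply: inj1; rewrite ?ZE ?Z0.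
  - by have := Z1 z f zZ fE zf; rewrite lf.
  - by have := Z1 z' f z'Z fE z'f; rewrite lf.
have /fin_all_exists[phi phi_spec] (z : {set T}) : exists f, z \in Z ->
    [/\ f \in E, f != z & meets z f].
  have [zZ|_] := boolP (z \in Z); last by exists z.
  have /nonisolatedP[f f_spec] : ~~ isolated adj z.
    by move: zZ; rewrite inE => /and4P[].
  by exists f.
pose P := phi @: Z.
have P2 f : f \in P -> 2 <= lev1 f.
  by move=> /imsetP[z zZ ->]; have [fE fz zf] := phi_spec z zZ; apply: (Zlev z).
pose X2 := [set e in E | (2 <= lev1 e) && (e \notin P)].
have X2E e : e \in X2 -> e \in E by rewrite inE => /andP[].
have [lev2 [inj2 min2]] := grundy_colouring X2 (@meetsC T).
pose R := [set e in E | 0 <= lev1 e < 0 + 2].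
(* [Q] collects the edges to be satisfied by colours on [R], the first two matchings. *)
pose Q := R :|: [set e in X2 | 0 <= lev2 e < 0 + t].
have Rd : degree_le R 2 by apply: degree_le_levels.
have Qd : degree_le Q (2 + t) by apply: degree_leU => //; apply: degree_le_levels.
have RE e : e \in R -> e \in E by rewrite inE => /andP[].
have QE e : e \in Q -> e \in E by rewrite inE => /orP[/RE|]; rewrite // inE => /andP[/X2E].
pose conflict f g := [exists e in Q, meets e f && meets e g].
have conflictC : symmetric conflict.
  by move=> f g; apply: eq_existsb => e; rewrite [X in _ && X]andbC.
have [lev3 [inj3 min3]] := grundy_colouring R conflictC.
have lev3_lt e : e \in R -> lev3 e <= 8 * t + 16.
  move=> eR; apply: grundy_le (fun j => min3 e j eR) _.
  (* An edge meets at most [2 * (2 + t)] edges of [Q], each of which meets at most [2 * 2] edges of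
     [R]. *)
  have -> : 8 * t + 16 = (2 * (2 + t)) * (2 * 2) by lia.
  pose Qe := [set f in Q | meets e f].
  apply: (@leq_trans (#|Qe| * (2 * 2))); last first.
    by rewrite leq_mul2r card_meets ?orbT ?E2 ?RE.
  apply: leq_trans (leq_card_bigcup_const (F := fun f => [set g in R | meets f g]) _).
    apply/subset_leq_card/subsetP => g; rewrite inE => /andP[gR /existsP[f]].
    move=> /and3P[fQ fe fg]; apply/bigcupP; exists f; last by rewrite inE gR.
    by rewrite inE fQ meetsC.
  by move=> f; rewrite inE => /andP[fQ _]; apply: card_meets; rewrite ?E2 ?QE.
have [||||||e j|S1 S1P] :=
  @random_submatchings T [set e in X2 | t <= lev2 e < t + k] X2 lev2 0 t k.
- exact: t1.
- exact: tk.
- by move=> e; rewrite inE => /andP[/X2E/E2].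
- by move=> e /X2E/E2.
- exact: degree_le_levels.
- exact: inj2.
- rewrite inE => /andP[eX le] lj; apply: min2 => //; lia.
have [||||||e j|S2 S2P] :=
  @random_submatchings T [set e in X2 | t + k <= lev2 e] X2 lev2 t k (maxdeg adj).
- exact: k1.
- exact: kD.
- by move=> e; rewrite inE => /andP[/X2E/E2].
- by move=> e /X2E/E2.
- apply: degree_leS (degree_le_edges adjC); apply/subsetP => e.
  by rewrite inE => /andP[/X2E].
- exact: inj2.
- rewrite inE => /andP[eX le] lj; apply: min2 => //; lia.
pose S := [set e | if lev2 e < t then e \in S1 else e \in S2].
(* Colours 0 and 1 serve [Z] and [P], colours from 3 to [19 + 8 * t] serve [R], and the selected
   submatchings use one colour per level from [20 + 8 * t] on. Colour 2 is a leftover class that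
   never serves as a witness. *)
pose c e := if e \in Z then 0 else if e \in P then 1 else
  if lev1 e < 2 then 3 + lev3 e else
  if (lev2 e < t + k) && (e \in S) then 20 + 8 * t + lev2 e else 2.
have c_lt e : e \in E -> c e < 20 + 9 * t + k.
  move=> eE; rewrite /c; case: ifP => _; first by lia.
  case: ifP => _; first by lia.
  case: ifP => l1; last by case: ifP => [/andP[]|]; lia.
  by have := lev3_lt e; rewrite inE eE /=; lia.
have cR e : e \in R -> e \notin Z -> c e = 3 + lev3 e.
  rewrite inE => /andP[eE l1] eZ; rewrite /c (negPf eZ); case: ifP => [/P2|_]; first by lia.
  by case: ifP => //; lia.
have c0 e : c e = 0 -> e \in Z by rewrite /c; do 4![case: ifP => //].
have c1 e : c e = 1 -> e \in P by rewrite /c; do 4![case: ifP => //].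
have c3 e : e \in E -> 3 <= c e < 20 + 8 * t -> e \in R.
  move=> eE; rewrite /c; do 2![case: ifP => // _].
  by case: ifP => [l1 _|_]; [rewrite inE eE | case: ifP; lia].
have c20 e : e \in E -> 20 + 8 * t <= c e -> [/\ e \in X2, lev2 e < t + k, e \in S & c e = 20 + 8 * t + lev2 e].
  move=> eE; rewrite /c; case: ifP => [_|eZ]; first by lia.
  case: ifP => [_|eP]; first by lia.
  case: ifP => [l1|l1]; first by have := lev3_lt e; rewrite inE eE l1 /=; lia.
  case: ifP => [/andP[l2 eS] _|]; last by lia.
  by rewrite inE eE eP; split=> //; lia.
have c2 e : e \in X2 -> lev2 e < t + k -> e \in S -> c e = 20 + 8 * t + lev2 e.
  rewrite inE => /and3P[eE l1 eP] l2 eS; rewrite /c (negPf eP) l2 eS.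
  case: ifP => [/Z0|_]; first by lia.
  by case: ifP => //; lia.
(* The witness has a lower level than [e], so it is not [e] itself. *)
have sat_level e j : j < lev2 e -> j < t + k ->
    singly_met [set f in X2 :&: S | lev2 f == j] e ->
    exists f, [/\ f \in E, f != e, meets e f &
       forall g, g \in E -> meets e g -> c g = c f -> g = f].
  move=> je jt [f [fL ef fu]]; move: (fL); rewrite !inE -/E => /andP[/andP[fX fS] /eqP lf].
  have {}fX : f \in X2 by rewrite inE.
  exists f; split => //; first exact: X2E.
    by apply: contraTneq je => <-; rewrite lf ltnn.
  have cf : c f = 20 + 8 * t + j by rewrite c2 ?lf // inE.
  move=> g gE eg; rewrite cf => cg; apply: fu => //.
  have [|gX lg gS cg'] := c20 g gE; first by rewrite cg leq_addr.
  by rewrite inE in_setI gX gS /=; apply/eqP; lia.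
apply: (cf_index_le (n := 19 + 9 * t + k) c_lt) => e eE e_nis.
have [eZ|eZ] := boolP (e \in Z).
  have [fE fz zf] := phi_spec e eZ; exists (phi e); split => // g gE eg.
  have phiP : phi e \in P by apply: imset_f.
  have -> : c (phi e) = 1.
    rewrite /c phiP; case: ifP => // /Z0; have := P2 _ phiP; lia.
  move/c1 => /imsetP[z zZ gz]; rewrite gz; congr phi.
  have [_ hz zh] := phi_spec z zZ; rewrite -gz in hz zh.
  by apply: (Zuniq z e g).
(* By [Zuniq], an edge outside [Z] meets at most one member of [Z], so colour 0 is unique for it. *)
have [/existsP[z /andP[zZ ez]]|eZ'] := boolP [exists z in Z, meets e z].
  have ez' : e != z by apply: contraNneq eZ => ->.
  exists z; split; rewrite 1?eq_sym ?ZE // => g gE eg.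
  rewrite {2}/c zZ => /c0 gZ; apply: (Zuniq g z e) => //; rewrite 1?meetsC //.
  by apply: contraNneq eZ => ->.
have nZ f : meets e f -> f \notin Z.
  by move=> ef; apply: contra eZ' => fZ; apply/existsP; exists f; rewrite fZ.
have eP : e \notin P.
  apply: contra eZ' => /imsetP[z zZ ephi]; have [_ _ zphi] := phi_spec z zZ.
  by apply/existsP; exists z; rewrite zZ meetsC ephi.
have [eQ|eQ] := boolP (e \in Q).
  (* An edge of level 0 outside [Z] meets one of level 1; any other edge meets one of level 0. *)
  have [f [fR fe ef]] : exists f, [/\ f \in R, f != e & meets e f].
    have [l0|l0] := posnP (lev1 e).
      move: eZ; rewrite inE eE l0 e_nis /= negbK => /existsP[f /and3P[fE ef /eqP lf]].
      by exists f; split => //; [rewrite inE fE lf | apply/eqP => fe; move: l0; rewrite -fe lf].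
    have [f [fE ef lf]] := min1 e 0 eE l0.
    exists f; split => //; first by rewrite inE fE lf.
    by apply: contraTneq l0 => <-; rewrite lf.
  exists f; split => //; first exact: RE.
  move=> g gE eg; rewrite (cR f) ?nZ // => cg.
  have gR : g \in R by apply: c3 => //; have := lev3_lt f fR; lia.
  apply: inj3 => //; last by move: cg; rewrite cR ?nZ //; lia.
  by apply/existsP; exists e; rewrite eQ eg ef.
have eX : e \in X2.
  by move: eQ; rewrite !inE eE eP andbT negb_or /= -leqNgt => /andP[->].
have lt_e : t <= lev2 e.
  by move: eQ; rewrite inE negb_or => /andP[_]; rewrite inE eX /= -leqNgt.
have [lk|lk] := ltnP (lev2 e) (t + k).
  have [|j lj met] := S1P e; first by rewrite inE eX lt_e.
  apply: (sat_level e j); [lia | lia |].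
  suff -> : [set f in X2 :&: S | lev2 f == j] = [set f in X2 :&: S1 | lev2 f == j] by [].
  apply/setP => f; rewrite !inE; case: eqP; rewrite ?andbF // => ->.
  by case: ifP => //; lia.
have [|j lj met] := S2P e; first by rewrite inE eX lk.
apply: (sat_level e j); [lia | lia |].
suff -> : [set f in X2 :&: S | lev2 f == j] = [set f in X2 :&: S2 | lev2 f == j] by [].
apply/setP => f; rewrite !inE; case: eqP; rewrite ?andbF // => ->.
by case: ifP => //; lia.
Qed.

(** * Choice of parameters and passage to real logarithms *)

Lemma linear_le_exp2 A : exists s0, forall s, s0 <= s -> A * s.+1 <= 2 ^ s.
Proof.
(* At [s = 2 * a], one factor [2 ^ a] absorbs [A] and the other [s.+1]; from then on the right side
   doubles. *)
pose a := A + 3; exists (2 * a) => s /subnKC <-.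
have leaS m : (m + 3).*2.+1 <= 2 ^ (m + 3).
  by elim: m => // m IHm; rewrite addSn expnS; lia.
elim: (s - _) => [|i IHi]; last by rewrite addnS expnS; lia.
rewrite addn0 mul2n -addnn expnD; have := leaS A; rewrite -/a; nia.
Qed.

(** With [s] about [l / (39 * K)], [19 * s + 20 <= 39 * s] gives the last bound, and
    [l + s <= 40 * K * s.+1] reduces the exponential one to the constant [1280 = 32 * 40]. *)
Lemma choose_parameters K : 0 < K -> exists l0, forall l, l0 <= l -> exists s,
  [/\ 0 < s, 32 * (l + s) <= 2 ^ s & K * (19 * s + 20) <= l].
Proof.
move=> K0; have [s0 exp_s] := linear_le_exp2 (1280 * K).
exists (39 * K * s0.+1) => l ll; exists (l %/ (39 * K)).
have le_s : s0.+1 <= l %/ (39 * K) by rewrite leq_divRL; lia.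
have := exp_s _ (ltnW le_s); have := divn_eq l (39 * K).
have : l %% (39 * K) < 39 * K by rewrite ltn_mod; lia.
move: le_s; move: (l %/ _) (l %% _) => s m; move: (2 ^ s) => x.
by split; nia.
Qed.

(* MathComp binds the key [R] to [ring_scope]. *)
Delimit Scope R_scope with R.

Lemma INR_le_log2 n l : (2 ^ l <= n)%N -> (INR l <= log2 (INR n))%R.
Proof.
move=> ln_; have ln2 : (0 < ln 2)%R by rewrite -ln_1; apply: ln_increasing; lra.
have INR_exp : INR (2 ^ l) = (2 ^ l)%R.
  elim: l {ln_} => //= l IHl; rewrite expnS mult_INR IHl /=; lra.
have pos : (0 < 2 ^ l)%R by apply: pow_lt; lra.
have le_n : (2 ^ l <= INR n)%R by rewrite -INR_exp; apply/le_INR/leP.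
apply: (Rmult_le_reg_r (ln 2)) => //.
rewrite /log2 /Rdiv Rmult_assoc Rinv_l ?Rmult_1_r; last by lra.
rewrite -ln_pow; last by lra.
by case: le_n => [lt|->]; [left; apply: ln_increasing | right].
Qed.

Theorem theorem1 :
  forall eps : R, (0 < eps)%R ->
  exists D : nat,
    forall (T : finType) (adj : rel T),
      symmetric adj -> irreflexive adj ->
      (D <= maxdeg adj)%N ->
      (INR (cf_index adj) <= (1 + eps) * log2 (INR (maxdeg adj)))%R.
Proof.
move=> eps eps0; have [K [Keps /ltP K0]] := archimed_cor1 eps eps0.
have [l0 params] := choose_parameters K0.
exists (2 ^ l0.+1) => T adj adjC adj_irr; set n := maxdeg adj => le_n.
have n0 : 0 < n by apply: leq_trans le_n; rewrite expn_gt0.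
pose l := trunc_log 2 n.
have l_le : 2 ^ l <= n by apply: trunc_logP.
have l_gt : n < 2 ^ l.+1 by apply: trunc_log_ltn.
have l0l : l0 < l by apply: trunc_log_max.
have [s [s0 exp_s K_s]] := params l (ltnW l0l).
have le_s : s < 2 ^ s by apply: ltn_expl.
(* Here [t = 2 * s] and [k = l + s]: the excess over [l] is [19 * s + 20], at most [l / K] and hence
   at most [eps * l]. *)
have cf_le : cf_index adj <= 20 + 9 * (2 * s) + (l + s).
  apply: cf_index_bound => //.
  - lia.
  - lia.
  - rewrite mul2n -addnn expnD; nia.
  - rewrite -/n expnD; move: l_gt; rewrite expnS; nia.
have le1 : (INR (cf_index adj) <= INR l + INR (19 * s + 20))%R.
  by rewrite -plus_INR; apply/le_INR/leP; lia.
have le2 : (INR (19 * s + 20) <= eps * INR l)%R.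
  have K0' : (0 < INR K)%R by apply/lt_0_INR/ltP.
  have le3 : (INR K * INR (19 * s + 20) <= INR l)%R.
    by rewrite -mult_INR; apply/le_INR/leP.
  have K1 : (1 <= eps * INR K)%R.
    have := Rmult_lt_compat_r _ _ _ K0' Keps; rewrite Rinv_l; lra.
  have := pos_INR (19 * s + 20); nra.
have := INR_le_log2 l_le; nra.
Qed.
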